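(* Let $b>-1$ and $\eta>0$, and consider the generalized Charlier weight $w(k)=\frac{\eta^k}{(b+1)_k\,k!}$, $k\in\mathbb N_0$, i.e. the case $\sigma(z)=\eta$, $\theta(z)=z(z+b)$ of the Pearson equation $\theta(k+1)w(k+1)=\sigma(k)w(k)$. Then the Laguerre--Freud structure matrix $\Psi=(\Psi_{n,m})_{n,m\in\mathbb N_0}$ is the banded matrix with entries, for all $n\in\mathbb N_0$, $$\Psi_{n,n}=\eta H_n,\qquad \Psi_{n,n+1}=(n+1)\,\eta H_n,\qquad \Psi_{n,n+2}=H_{n+2},$$ and all other entries equal to zero; that is, $$\Psi=\begin{bmatrix}\eta H_0&\eta H_0&H_2&0&0&\cdots\\0&\eta H_1&2\eta H_1&H_3&0&\cdots\\0&0&\eta H_2&3\eta H_2&H_4&\cdots\\\vdots&&&\ddots&\ddots&\ddots\end{bmatrix}.$$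
   Context: $\mathbb N_0=\{0,1,2,\dots\}$; $(x)_k=x(x+1)\cdots(x+k-1)$ is the Pochhammer symbol. For a weight $w$ on $\mathbb N_0$, $\{P_n\}_{n\ge0}$ are the monic orthogonal polynomials, $\deg P_n=n$, with $\sum_{k\ge0}P_n(k)P_m(k)w(k)=\delta_{n,m}H_n$, $H_n\ne0$. They satisfy $zP_n(z)=P_{n+1}(z)+\beta_nP_n(z)+\gamma_nP_{n-1}(z)$ with $P_{-1}=0$, and $\gamma_{n+1}=H_{n+1}/H_n$. Rows and columns of semi-infinite matrices are indexed by $\mathbb N_0$. $J$ is the tridiagonal Jacobi matrix with $J_{n,n}=\beta_n$, $J_{n,n+1}=1$, $J_{n+1,n}=\gamma_{n+1}$; $H=\operatorname{diag}(H_0,H_1,\dots)$; $P(z)=(P_0(z),P_1(z),\dots)^\top$. The dressed Pascal matrix $\Pi$ is the lower unitriangular semi-infinite matrix determined by $P(z+1)=\Pi P(z)$ (so $P(z-1)=\Pi^{-1}P(z)$). For a weight satisfying $\theta(k+1)w(k+1)=\sigma(k)w(k)$, $k\in\mathbb N_0$, with polynomials $\theta,\sigma$, $\theta(0)=0$, the Laguerre--Freud structure matrix is $\Psi:=\Pi^{-1}H\theta(J^\top)$, which also equals $\sigma(J)H\Pi^\top$. *)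

(* Defs.v *)
From HB Require Import structures.
From mathcomp Require Import all_boot all_order all_algebra.
From mathcomp Require Import all_classical all_reals all_analysis.
From mathcomp Require Import ring.

Set Implicit Arguments.
Unset Strict Implicit.
Unset Printing Implicit Defensive.

Import Order.TTheory GRing.Theory Num.Theory.
Import numFieldNormedType.Exports.

Local Open Scope classical_set_scope.
Local Open Scope ring_scope.

Section SemiInfiniteMatrices.
Variable R : comNzRingType.

Definition smx := nat -> nat -> R.

Implicit Types A B : smx.

(* Finitely supported sum (0 by convention on infinite supports).  The products
   formed below have left factors with finitely many nonzero entries per row
   (lower triangular or banded), so the convention is harmless. *)
Definition smul A B : smx :=
  fun n m => \sum_(k \in [set: nat]) (A n k * B k m).

Definition smulv A (v : nat -> R) : nat -> R :=
  fun n => \sum_(k \in [set: nat]) (A n k * v k).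

Definition sid : smx := fun n m => (n == m)%:R.

Definition sdiag (d : nat -> R) : smx := fun n m => d n *+ (n == m).

Definition strans A : smx := fun n m => A m n.

Definition spow A (k : nat) : smx := iter k (smul A) sid.

Definition spoly (p : {poly R}) A : smx :=
  fun n m => \sum_(i < size p) p`_i * spow A i n m.

Definition lower_unitriangular A : Prop :=
  (forall n, A n n = 1) /\ (forall n m, (n < m)%N -> A n m = 0).

Definition sinverse A B : Prop := smul A B = sid /\ smul B A = sid.

(* The subdiagonal entry (n+1, n) is [gamma n.+1]; [gamma 0] never occurs, in
   accordance with P_{-1} = 0 in [three_term]. *)
Definition jacobi (beta gamma : nat -> R) : smx :=
  fun n m => if m == n then beta n
             else if m == n.+1 then 1
             else if n == m.+1 then gamma n
             else 0.

Definition three_term (P : nat -> {poly R}) (beta gamma : nat -> R) : Prop :=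
  forall n, 'X * P n =
    P n.+1 + beta n *: P n + (if n is n'.+1 then gamma n *: P n' else 0).

Definition polvec (P : nat -> {poly R}) (z : R) : nat -> R :=
  fun n => (P n).[z].

(* Unitriangularity makes the rows of Pi finite, and the polynomials P_n being a
   basis, these two conditions determine Pi. *)
Definition dressed_pascal (P : nat -> {poly R}) (Pi : smx) : Prop :=
  lower_unitriangular Pi /\
  forall z, polvec P (z + 1) = smulv Pi (polvec P z).

(* [Pinv] stands for the inverse of the dressed Pascal matrix. *)
Definition laguerre_freud (Pinv : smx) (H beta gamma : nat -> R)
    (theta : {poly R}) : smx :=
  smul (smul Pinv (sdiag H)) (spoly theta (strans (jacobi beta gamma))).

Definition pochhammer (x : R) (k : nat) : R := \prod_(i < k) (x + i%:R).

End SemiInfiniteMatrices.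

Definition monic_orthogonal (R : realType) (w : nat -> R)
    (P : nat -> {poly R}) (H : nat -> R) : Prop :=
  [/\ forall n, P n \is monic /\ size (P n) = n.+1,
      forall n m, series (fun k : nat => (P n).[k%:R] * (P m).[k%:R] * w k) @ \oo
                    --> H n *+ (n == m)
    & forall n, H n != 0].

Definition pearson (R : realType) (w : nat -> R) (theta sigma : {poly R}) : Prop :=
  theta.[0] = 0 /\
  forall k : nat, theta.[k.+1%:R] * w k.+1 = sigma.[k%:R] * w k.

Section GeneralizedCharlier.
Variable R : realType.
Implicit Types b eta : R.

Definition charlier_weight b eta (k : nat) : R :=
  eta ^+ k / (pochhammer (b + 1) k * (k`!)%:R).

Definition charlier_theta b : {poly R} := 'X * ('X + b%:P).

Definition charlier_sigma eta : {poly R} := eta%:P.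

Lemma charlier_pearson b eta : -1 < b ->
  pearson (charlier_weight b eta) (charlier_theta b) (charlier_sigma eta).
Proof.
move=> hb; split; first by rewrite /charlier_theta !hornerE.
have hp i : b + 1 + i%:R != 0 :> R.
  by rewrite gt_eqF// ltr_wpDr ?ler0n// addrC -ltrBlDl sub0r.
move=> k; rewrite /charlier_theta /charlier_sigma hornerM hornerD hornerX !hornerC /charlier_weight.
have hP : pochhammer (b + 1) k != 0.
  by rewrite /pochhammer; apply/prodf_neq0 => i _; exact: hp.
have -> : pochhammer (b + 1) k.+1 = pochhammer (b + 1) k * (b + 1 + k%:R).
  by rewrite /pochhammer big_ord_recr.
rewrite factS natrM exprS -!natr1.
have hk : k%:R + 1 != 0 :> R by rewrite natr1 pnatr_eq0.
have hf : (k`!)%:R != 0 :> R by rewrite pnatr_eq0 -lt0n fact_gt0.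
have h := hp k.
by field; rewrite hf hP hk h.
Qed.

End GeneralizedCharlier.

(* Main.v *)
(* Let [L] be the functional p |-> \sum_k p(k) w(k), finite on every polynomial
   because it is finite on all P_n * P_m.  Orthogonality turns the entry (n, m)
   of Psi into L(theta(z) P_m(z) P_n(z - 1)), since the rows of Pi^-1 are the
   coordinates of P_n(z - 1).  As theta(z) P_n(z - 1) is monic of degree n + 2,
   this is H_(n+2) for m = n + 2 and 0 for m > n + 2.  The Pearson equation
   rewrites it as eta * L(P_m(z + 1) P_n(z)), which only sees the coefficient of
   z^n in P_m(z + 1), corrected by one step of orthogonality when m = n + 1. *)
Require Import Defs.
From HB Require Import structures.
From mathcomp Require Import all_boot all_order all_algebra.
From mathcomp Require Import all_classical all_reals all_analysis.

Set Implicit Arguments.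
Unset Strict Implicit.
Unset Printing Implicit Defensive.

Import Order.TTheory GRing.Theory Num.Theory.
Import numFieldNormedType.Exports.
Local Open Scope ring_scope.

(** Turns the finitely supported sums of [smul] and [smulv] into ordinary ones; triangularity or
    band width supplies the bound [N]. *)
Lemma fsumT_ord (R : nmodType) (N : nat) (F : nat -> R) :
  (forall k, (N <= k)%N -> F k = 0) ->
  \sum_(k \in [set: nat]) F k = \sum_(k < N) F k.
Proof.
move=> F0; rewrite fsbig_ord; apply/esym/fsbig_widen => //= k [_ /negP].
by rewrite -leqNgt => /F0.
Qed.

Lemma size_sub_coef_monic (R : nzRingType) (p q : {poly R}) (n : nat) :
  p \is monic -> size p = n.+1 -> (size q <= n.+1)%N ->
  (size (q - q`_n *: p)%R <= n)%N.
Proof.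
move=> /monicP p1 sp sq; apply/leq_sizeP => j; rewrite leq_eqVlt coefB coefZ.
case/orP => [/eqP <-|nj].
  by rewrite -[p`_n]/(p`_n.+1.-1) -sp -lead_coefE p1 mulr1 subrr.
by rewrite (nth_default 0 (leq_trans sq nj)) (@nth_default _ 0 p) ?mulr0 ?subr0 ?sp.
Qed.

Lemma coef_Xadd1_exp (R : comNzRingType) (i n : nat) :
  (('X + 1 : {poly R}) ^+ i)`_n = 'C(i, n)%:R.
Proof.
rewrite exprDn coef_sum; under eq_bigr do rewrite expr1n mulr1 coefMn coefXn.
have [ni|ni] := leqP n i.
  rewrite (bigD1 (inord (i - n))) //= inordK ?ltnS ?leq_subr// subKn// eqxx.
  rewrite bin_sub// big1 ?addr0// => j /eqP ji.
  case: eqP => [nE|]; last by rewrite mul0rn.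
  by case: ji; apply/val_inj; rewrite /= inordK ?ltnS ?leq_subr// nE subKn// -ltnS.
rewrite bin_small// big1// => j _; case: eqP => [nE|]; last by rewrite mul0rn.
by move: ni; rewrite nE ltnNge leq_subr.
Qed.

(** In the binomial expansion of p(z + 1), only the powers n and n + 1 reach z^n, with binomials 1
    and n + 1. *)
Lemma coef_shift_lead (R : comNzRingType) (p : {poly R}) (n : nat) :
  (size p <= n.+2)%N ->
  (p \Po ('X + 1))`_n = p`_n + p`_n.+1 *+ n.+1.
Proof.
move=> sp; rewrite coef_comp_poly.
rewrite -(big_mkord xpredT (fun i => p`_i * (('X + 1) ^+ i)`_n)).
rewrite (@big_nat_widen _ _ _ _ _ n.+2)//= big_mkcond /=.
rewrite (eq_bigr (fun i => p`_i * 'C(i, n)%:R)); last first.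
  move=> i _; rewrite coef_Xadd1_exp; case: ltnP => // /(nth_default 0) ->.
  by rewrite mul0r.
rewrite big_mkord !big_ord_recr /= big1 ?add0r => [|i _].
  by rewrite binn binSn mulr1 mulr_natr.
by rewrite bin_small// mulr0.
Qed.

(** * Orthogonality for an abstract functional *)

Section OrthogonalFunctional.
Variables (R : comNzRingType) (L : {scalar {poly R}}).
Variables (P : nat -> {poly R}) (H : nat -> R).
Hypothesis Pmonic : forall n, P n \is monic /\ size (P n) = n.+1.
Hypothesis LP : forall n m, L (P n * P m) = H n *+ (n == m).

Lemma orthogonal_low m (q : {poly R}) : (size q <= m)%N -> L (P m * q) = 0.
Proof.
(* Induction on a size bound d: subtracting a multiple of P_d, which is orthogonal to P_m as d < m,
   lowers the size. *)
suff Ld d : (d <= m)%N -> forall p : {poly R}, (size p <= d)%N -> L (P m * p) = 0.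
  exact: (Ld m).
elim: d => [_ p|d IH dm p sp].
  by rewrite leqn0 size_poly_eq0 => /eqP->; rewrite mulr0 raddf0.
have [Pd sPd] := Pmonic d.
rewrite -(subrK (p`_d *: P d) p) mulrDr raddfD /= IH ?(ltnW dm)//; last first.
  exact: size_sub_coef_monic.
by rewrite -scalerAr linearZ /= LP gtn_eqF// mulr0 addr0.
Qed.

Lemma orthogonal_coef m (q : {poly R}) :
  (size q <= m.+1)%N -> L (P m * q) = q`_m * H m.
Proof.
move=> sq; have [Pm sPm] := Pmonic m.
rewrite -[q in LHS](subrK (q`_m *: P m)) mulrDr raddfD /=.
rewrite orthogonal_low ?size_sub_coef_monic// add0r.
by rewrite -scalerAr linearZ /= LP eqxx.
Qed.

Variables beta gamma : nat -> R.
Hypothesis hJ : three_term P beta gamma.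
Local Notation J := (jacobi beta gamma).

Lemma jacobi_eq0 k j : (k.+2 <= j)%N -> J k j = 0 /\ J j k = 0.
Proof.
move=> kj; have kj1 : (k < j)%N by exact: leq_trans kj.
rewrite /jacobi (gtn_eqF kj1) (gtn_eqF kj) (ltn_eqF kj1).
by rewrite !ltn_eqF// ?(ltn_trans kj1)// ltnW.
Qed.

Lemma jacobi_mulX k : 'X * P k = \sum_(j < k.+2) J k j *: P j.
Proof.
rewrite hJ; case: k => [|k]; rewrite !big_ord_recr /= ?big_ord0.
  by rewrite /jacobi /= add0r addr0 scale1r addrC.
rewrite big1 => [|i _]; last first.
  have ik := ltn_ord i.
  rewrite /jacobi (@ltn_eqF i k.+1) ?(@ltn_eqF i k.+2) ?(@gtn_eqF i.+1 k.+1) //.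
  - by rewrite scale0r.
  - exact: ltn_trans (ltnW _).
  - exact: ltnW.
rewrite add0r /jacobi !eqxx /= ltn_eqF// ltn_eqF// gtn_eqF// scale1r.
by rewrite [RHS]addrC [X in _ = _ + X]addrC addrA.
Qed.

(** The left side is symmetric in k and j, so this yields J H = H J^T without computing [gamma]. *)
Lemma jacobi_moment k j : L ('X * P k * P j) = J k j * H j.
Proof.
rewrite jacobi_mulX mulr_suml raddf_sum /=.
under eq_bigr do rewrite -scalerAl linearZ /= LP mulrnAr.
have [jk|kj] := ltnP j k.+2.
  rewrite (bigD1 (Ordinal jk)) //= eqxx mulr1n big1 ?addr0// => i /eqP ij.
  by case: eqP => // e; case: ij; apply/val_inj.
rewrite (jacobi_eq0 kj).1 mul0r big1// => i _.
by rewrite ltn_eqF// (leq_trans _ kj).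
Qed.

Lemma spow_moment i k m :
  L ('X^i * P m * P k) = H k * spow (strans J) i k m.
Proof.
elim: i k => [|i IH] k.
  rewrite expr0 mul1r LP /spow /= /sid eq_sym mulr_natr.
  by case: eqP => // ->.
(* One factor z moves onto P_k and is expanded by row k of J; this symmetry then turns that row into
   row k of J^T, past H. *)
have sym j : J k j * H j = J j k * H k.
  by rewrite -!jacobi_moment -!mulrA [P k * _]mulrC.
have -> : 'X^(i.+1) * P m * P k = 'X^i * P m * ('X * P k).
  by rewrite exprSr -!mulrA (mulrCA 'X).
rewrite jacobi_mulX mulr_sumr raddf_sum /=.
rewrite -/(spow _ i) /smul (@fsumT_ord _ k.+2) => [|j kj]; last first.
  by rewrite /strans (jacobi_eq0 kj).2 mul0r.
rewrite mulr_sumr; apply: eq_bigr => j _.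
by rewrite -scalerAr linearZ /= IH [LHS]mulrA sym [RHS]mulrCA [RHS]mulrA.
Qed.

Lemma spoly_moment (theta : {poly R}) k m :
  L (theta * P m * P k) = H k * spoly theta (strans J) k m.
Proof.
rewrite -[theta in LHS]coefK poly_def !mulr_suml raddf_sum mulr_sumr /=.
apply: eq_bigr => i _.
by rewrite -!scalerAl linearZ /= spow_moment mulrCA.
Qed.

(** The entries of H theta(J^T) are the moments of [spoly_moment], and row n of [Pinv] is finite, so
    the combination passes inside L. *)
Lemma laguerre_freud_moment (Pinv : smx R) (theta : {poly R}) n m :
  lower_unitriangular Pinv ->
  laguerre_freud Pinv H beta gamma theta n m =
  L (theta * (P m * \sum_(k < n.+1) Pinv n k *: P k)).
Proof.
move=> [_ low].
have diagE k : smul Pinv (sdiag H) n k = Pinv n k * H k.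
  rewrite /smul (@fsumT_ord _ n.+1) => [|j nj]; last by rewrite low// mul0r.
  have [kn|nk] := ltnP k n.+1.
    rewrite (bigD1 (Ordinal kn)) //= /sdiag eqxx big1 ?addr0// => j /eqP jk.
    by case: eqP => [e|_]; [case: jk; apply/val_inj | rewrite mulr0].
  rewrite low// mul0r big1// => j _.
  by rewrite /sdiag ltn_eqF ?mulr0// (leq_trans _ nk).
rewrite /laguerre_freud {1}/smul (@fsumT_ord _ n.+1) => [|k nk]; last first.
  by rewrite diagE low// !mul0r.
rewrite !mulr_sumr raddf_sum /=; apply: eq_bigr => k _.
by rewrite diagE -!scalerAr linearZ /= mulrA spoly_moment mulrA.
Qed.

End OrthogonalFunctional.

(** * The inverse of the dressed Pascal matrix *)

Section DressedPascal.
Variable R : comNzRingType.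
Implicit Types Pi Pinv : smx R.

(** Forward substitution: row n of Pi Pinv = I determines row n of [Pinv] from the earlier rows.
    [sinverse] itself prescribes no shape. *)
Lemma right_inverse_lower_unitriangular Pi Pinv :
  lower_unitriangular Pi -> smul Pi Pinv = sid R -> lower_unitriangular Pinv.
Proof.
move=> [Pi1 Pi0] PiK.
have rec n m : \sum_(k < n) Pi n k * Pinv k m + Pinv n m = (n == m)%:R.
  rewrite -[RHS]/(sid R n m) -PiK /smul (@fsumT_ord _ n.+1) => [|k nk].
    by rewrite big_ord_recr /= Pi1 mul1r.
  by rewrite Pi0// mul0r.
have low n m : (n < m)%N -> Pinv n m = 0.
  elim/ltn_ind: n => n IH nm; have := rec n m.
  rewrite ltn_eqF// big1 ?add0r// => k _.
  by rewrite IH ?mulr0// (ltn_trans _ nm).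
split=> // n; have := rec n n; rewrite eqxx big1 ?add0r// => k _.
by rewrite low ?mulr0.
Qed.

(** The sum is P_n(z - 1); evaluating it at z + 1 matches the shift k to k + 1 of the Pearson
    equation. *)
Lemma dressed_pascal_inverse (P : nat -> {poly R}) Pi Pinv n z :
  dressed_pascal P Pi -> lower_unitriangular Pinv -> smul Pinv Pi = sid R ->
  (\sum_(k < n.+1) Pinv n k *: P k).[z + 1] = (P n).[z].
Proof.
move=> [[_ Pi0] shiftP] [_ low] PiK.
have shift k : (k < n.+1)%N ->
    (P k).[z + 1] = \sum_(j < n.+1) Pi k j * (P j).[z].
  move=> kn; rewrite -[LHS]/(polvec P (z + 1) k) shiftP /smulv.
  rewrite (@fsumT_ord _ n.+1)// => j nj.
  by rewrite Pi0 ?mul0r// (leq_trans _ nj).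
have PiKE j : \sum_(k < n.+1) Pinv n k * Pi k j = (n == j)%:R.
  rewrite -[RHS]/(sid R n j) -PiK /smul (@fsumT_ord _ n.+1)// => k nk.
  by rewrite low// mul0r.
rewrite horner_sum; under eq_bigr do rewrite hornerZ shift// mulr_sumr.
rewrite exchange_big /=; under eq_bigr do
  under eq_bigr do rewrite mulrA.
under eq_bigr do rewrite -mulr_suml PiKE.
rewrite (bigD1 ord_max) //= eqxx mul1r big1 ?addr0// => j /eqP jn.
by case: eqP => [e|_]; [case: jn; apply/val_inj | rewrite mul0r].
Qed.

End DressedPascal.

(** * The moment functional of a weight *)

Section MomentFunctional.
Local Open Scope classical_set_scope.
Variables (R : realType) (w : nat -> R).

Let sums (p : {poly R}) : R^nat := series (fun k : nat => p.[k%:R] * w k).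

Let sumsD p q : sums (p + q) = sums p + sums q.
Proof.
rewrite -seriesD; congr series; apply/funext => k.
by rewrite hornerD mulrDl.
Qed.

Let sumsZ c p : sums (c *: p) = c *: sums p.
Proof.
rewrite -seriesZ; congr series; apply/funext => k.
by rewrite hornerZ -mulrA.
Qed.

Lemma moment_functional (P : nat -> {poly R}) (H : nat -> R) :
  monic_orthogonal w P H ->
  exists L : {scalar {poly R}}, forall p : {poly R},
    series (fun k : nat => p.[k%:R] * w k) @ \oo --> L p.
Proof.
move=> [Pmonic orth _].
(* With P_0 = 1, the orthogonality relations for (n, 0) give convergence on each P_n; removing
   leading terms extends it to all polynomials. *)
have P0 : P 0 = 1.
  have [/monicP P1 /eqP/size_poly1P[c _ P0]] := Pmonic 0.
  by move: P1; rewrite P0 lead_coefC => ->.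
have cvgP n : cvgn (sums (P n)).
  have := orth n 0; rewrite P0.
  under [in X in series X]eq_fun do rewrite hornerE mulr1.
  by move=> /cvgP.
have cvg_sums p : cvgn (sums p).
  have [n] := ubnP (size p); elim: n p => // n IH p sp.
  have [/eqP|p0] := posnP (size p).
    rewrite size_poly_eq0 => /eqP ->.
    by rewrite -(scale0r (P 0)) sumsZ; exact: is_cvgZl_tmp.
  have [Pd sPd] := Pmonic (size p).-1.
  rewrite -(subrK (p`_(size p).-1 *: P (size p).-1) p) sumsD sumsZ.
  apply: is_cvgD; last exact: is_cvgZl_tmp.
  by apply: IH; rewrite (leq_ltn_trans (size_sub_coef_monic Pd sPd _)) ?prednK//.
have lin : scalar (fun p : {poly R} => limn (sums p)).
  move=> c p q; rewrite sumsD sumsZ limD//; last exact: is_cvgZl_tmp.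
  by rewrite limZl_tmp.
pose Lm := GRing.isLinear.Build _ _ _ _ _ lin.
pose L : {scalar {poly R}} := HB.pack (fun p : {poly R} => limn (sums p)) Lm.
by exists L => p; exact: cvg_sums.
Qed.

Lemma moment_pearson (L : {scalar {poly R}}) (theta sigma p q : {poly R}) :
  (forall r : {poly R},
    series (fun k : nat => r.[k%:R] * w k) @ \oo --> L r) ->
  pearson w theta sigma -> (forall k : nat, p.[k.+1%:R] = q.[k%:R]) ->
  L (theta * p) = L (sigma * q).
Proof.
move=> LE [theta0 pearsonE] pq.
(* As theta(0) = 0, the term k = 0 drops out, and Pearson matches the term k + 1 on one side with
   the term k on the other. *)
have sumsE : sums (sigma * q) = [sequence sums (theta * p) n.+1]_n.
  apply/funext => n; rewrite /sums !seriesEord /= big_ord_recl.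
  rewrite hornerM theta0 !mul0r add0r; apply: eq_bigr => k _.
  by rewrite lift0 !hornerM pq mulrAC -pearsonE mulrAC.
have LtE : sums (sigma * q) @ \oo --> L (theta * p).
  by rewrite sumsE (@cvg_shiftS _ (sums (theta * p))); exact: LE.
exact: (cvg_unique _ LtE (LE (sigma * q))).
Qed.

End MomentFunctional.

Theorem theorem3 (R : realType) (b eta : R) (hb : -1 < b) (heta : 0 < eta)
    (P : nat -> {poly R}) (H beta gamma : nat -> R) (Pi Pinv : smx R)
    (hP : monic_orthogonal (charlier_weight b eta) P H)
    (hJ : three_term P beta gamma)
    (hPi : dressed_pascal P Pi)
    (hPinv : sinverse Pi Pinv) :
  let Psi := laguerre_freud Pinv H beta gamma (charlier_theta b) in
  forall n : nat,
    [/\ Psi n n = eta * H n,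
        Psi n n.+1 = n.+1%:R * eta * H n,
        Psi n n.+2 = H n.+2
      & forall m : nat, m != n -> m != n.+1 -> m != n.+2 -> Psi n m = 0].
Proof.
have [L LE] := moment_functional hP; case: hP => Pmonic orth _.
case: hPinv => PiK PinvK.
have low := right_inverse_lower_unitriangular hPi.1 PiK.
have LP n m : L (P n * P m) = H n *+ (n == m).
  apply: (cvg_unique _ (LE _)) => //.
  by under [in X in series X]eq_fun do rewrite hornerM; exact: orth.
move=> Psi n.
(* Q(z) = P_n(z - 1). *)
set Q := \sum_(k < n.+1) Pinv n k *: P k.
have QE z : Q.[z + 1] = (P n).[z] by exact: dressed_pascal_inverse hPi low PinvK.
have PsiE m : Psi n m = L (charlier_theta b * (P m * Q)).
  exact: laguerre_freud_moment.
have Psi_shiftE m : Psi n m = eta * L (P n * (P m \Po ('X + 1))).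
  rewrite PsiE (moment_pearson (q := P n * (P m \Po ('X + 1))) LE
    (charlier_pearson eta hb)) => [|k]; last first.
    by rewrite !hornerM -natr1 QE horner_comp !hornerE mulrC.
  by rewrite /charlier_sigma mul_polyC linearZ.
have coefP m : (P m)`_m = 1.
  by have [/monicP + sPm] := Pmonic m; rewrite lead_coefE sPm.
have size_shift m : size (P m \Po ('X + 1)) = m.+1.
  by rewrite size_comp_poly2 ?size_XaddC// (Pmonic m).2.
have [Pn_monic sPn] := Pmonic n.
(* The unit diagonal of [Pinv] makes Q monic of degree n. *)
have Q_split : Q = \sum_(k < n) Pinv n k *: P k + P n.
  by rewrite /Q big_ord_recr /= low.1 scale1r.
have sQ_low : (size (\sum_(k < n) Pinv n k *: P k)%R < size (P n))%N.
  rewrite sPn ltnS; apply: leq_trans (size_sum _ _ _) _.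
  apply/bigmax_leqP => k _.
  by rewrite (leq_trans (size_scale_leq _ _))// (Pmonic k).2.
have Q_monic : Q \is monic.
  by rewrite monicE Q_split lead_coefDr// -monicE.
have sQ : size Q = n.+1 by rewrite Q_split addrC size_polyDl.
have theta_monic : charlier_theta b \is monic.
  by rewrite monicMl ?monicX ?monicXaddC.
have sT : size (charlier_theta b * Q) = n.+3.
  rewrite size_Mmonic ?monic_neq0// sQ /charlier_theta size_Mmonic ?monicXaddC//.
    by rewrite size_polyX size_XaddC.
  by rewrite polyX_eq0.
have T_lead : (charlier_theta b * Q)`_n.+2 = 1.
  have /monicP : charlier_theta b * Q \is monic by rewrite monicMl.
  by rewrite lead_coefE sT.
have Psi_degE m : Psi n m = L (P m * (charlier_theta b * Q)).
  by rewrite PsiE mulrCA.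
split.
- rewrite Psi_shiftE (orthogonal_coef Pmonic LP) ?size_shift//.
  rewrite coef_shift_lead ?(Pmonic n).2//.
  by rewrite coefP nth_default ?(Pmonic n).2// mul0rn addr0 mul1r.
(* Here s has degree n + 1, too large for [orthogonal_coef] at n. Subtracting P_(n+1), which is
   orthogonal to P_n, leaves degree at most n, and the coefficient of z^n is n + 1. *)
- rewrite Psi_shiftE; set s := P n.+1 \Po _.
  have s_coef : s`_n.+1 = 1.
    rewrite coef_shift_lead ?(Pmonic _).2// coefP nth_default ?(Pmonic _).2//.
    by rewrite mul0rn addr0.
  have [Pm sPm] := Pmonic n.+1.
  have sd : (size (s - P n.+1)%R <= n.+1)%N.
    by rewrite -[P _]scale1r -s_coef size_sub_coef_monic// size_shift.
  rewrite -(subrK (P n.+1) s) mulrDr raddfD /= LP ltn_eqF// addr0.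
  rewrite (orthogonal_coef Pmonic LP)// coefB coef_shift_lead ?sPm// coefP.
  by rewrite addrC addKr mulrCA mulrA.
- by rewrite Psi_degE (orthogonal_coef Pmonic LP) ?sT// T_lead mul1r.
(* Below the diagonal P_m(z + 1) has degree m < n; beyond n + 2, theta Q has degree n + 2 < m. *)
- move=> m mn mn1 mn2; have [lmn|] := ltnP m n.
    by rewrite Psi_shiftE (orthogonal_low Pmonic LP) ?mulr0 ?size_shift//.
  rewrite leq_eqVlt eq_sym (negbTE mn) leq_eqVlt eq_sym (negbTE mn1) /=.
  rewrite leq_eqVlt eq_sym (negbTE mn2) /= => nm.
  by rewrite Psi_degE (orthogonal_low Pmonic LP) ?sT.
Qed.
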